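(* Let $X$ be a $G$-space and let $f:X\rightarrow X$ be pseudoequivariant. If $f$ is weakly $G$-mixing, then $f$ is totally $G$-transitive.
   Context: A $G$-space $X$ is a topological space $X$ together with a topological group $G$ and a continuous action $G\times X\to X$, $(g,x)\mapsto g.x$. For $x\in X$, $G(x)=\{g.x:g\in G\}$; for $A\subseteq X$, $g.A=\{g.a:a\in A\}$. A map $f:X\to X$ is pseudoequivariant if it is continuous and $f(G(x))=G(f(x))$ for every $x\in X$. $\mathbb{N}$ is the set of positive integers and $f^k$ is the $k$-th iterate of $f$. A continuous map $f:X\to X$ is $G$-transitive if for any pair of nonempty open subsets $U,V$ of $X$ there exist $g\in G$ and $k\in\mathbb{N}$ with $g.f^k(U)\cap V\neq\emptyset$. It is totally $G$-transitive if $f^n$ is $G$-transitive for every $n\geqslant 1$. The product $X\times X$ is a $G\times G$-space under $(g,h).(x,y)=(g.x,h.y)$. A continuous map $f:X\to X$ is weakly $G$-mixing if $f\times f$ is $G\times G$-transitive on $X\times X$; equivalently, for all nonempty open $U,V,E,F\subseteq X$ there exist $(g,h)\in G\times G$ and $k\in\mathbb{N}$ such that $g.f^k(U)\cap E\neq\emptyset$ and $h.f^k(V)\cap F\neq\emptyset$. *)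

(* Defs.v *)
From HB Require Import structures.
From mathcomp Require Import all_boot all_classical topology.

Set Implicit Arguments.
Unset Strict Implicit.
Unset Printing Implicit Defensive.

Local Open Scope classical_set_scope.
Local Open Scope group_scope.

HB.mixin Record Group_isTopologicalGroup G of Topological G & Group G := {
  mulg_continuous : continuous (fun p : G * G => p.1 * p.2) ;
  invg_continuous : continuous (fun x : G => x^-1)
}.

#[short(type="topologicalGroupType")]
HB.structure Definition TopologicalGroup :=
  {G of Group_isTopologicalGroup G & Topological G & Group G}.

HB.mixin Record Topological_isGSpace (G : topologicalGroupType) X
    of Topological X := {
  gact : G -> X -> X ;
  gact1 : forall x, gact 1 x = x ;
  gactM : forall g h x, gact (g * h) x = gact g (gact h x) ;
  gact_continuous : continuous (fun p : G * X => gact p.1 p.2)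
}.

#[short(type="gSpaceType")]
HB.structure Definition GSpace (G : topologicalGroupType) :=
  {X of Topological_isGSpace G X & Topological X}.

Lemma pair_continuous (T U V : topologicalType) (f : T -> U) (g : T -> V) :
  continuous f -> continuous g -> continuous (fun x => (f x, g x)).
Proof. by move=> fc gc x; apply: cvg_pair; [exact: fc|exact: gc]. Qed.

Lemma fst_continuous (T U : topologicalType) : continuous (fst : T * U -> T).
Proof. by move=> p; exact: cvg_fst. Qed.

Lemma snd_continuous (T U : topologicalType) : continuous (snd : T * U -> U).
Proof. by move=> p; exact: cvg_snd. Qed.

Lemma comp_continuous (T U V : topologicalType) (f : T -> U) (g : U -> V) :
  continuous f -> continuous g -> continuous (g \o f).
Proof. by move=> fc gc x; apply: continuous_comp; [exact: fc|exact: gc]. Qed.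

Lemma fst_fst_continuous (T U V W : topologicalType) :
  continuous (fun q : (T * U) * (V * W) => (q.1.1, q.2.1)).
Proof.
exact: (pair_continuous
  (comp_continuous (@fst_continuous _ _) (@fst_continuous _ _))
  (comp_continuous (@snd_continuous _ _) (@fst_continuous _ _))).
Qed.

Lemma snd_snd_continuous (T U V W : topologicalType) :
  continuous (fun q : (T * U) * (V * W) => (q.1.2, q.2.2)).
Proof.
exact: (pair_continuous
  (comp_continuous (@fst_continuous _ _) (@snd_continuous _ _))
  (comp_continuous (@snd_continuous _ _) (@snd_continuous _ _))).
Qed.

Section ProductTopologicalGroup.
Variables G H : topologicalGroupType.

Let pair_mulg_continuous :
  continuous (fun p : (G * H) * (G * H) => p.1 * p.2).
Proof.
exact: (pair_continuous
  (comp_continuous (@fst_fst_continuous G H G H) (@mulg_continuous G))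
  (comp_continuous (@snd_snd_continuous G H G H) (@mulg_continuous H))).
Qed.

Let pair_invg_continuous : continuous (fun p : G * H => p^-1).
Proof.
exact: (pair_continuous
  (comp_continuous (@fst_continuous G H) (@invg_continuous G))
  (comp_continuous (@snd_continuous G H) (@invg_continuous H))).
Qed.

HB.instance Definition _ := Group_isTopologicalGroup.Build (G * H)%type
  pair_mulg_continuous pair_invg_continuous.

End ProductTopologicalGroup.

Section ProductGSpace.
Variables (G H : topologicalGroupType) (X : gSpaceType G) (Y : gSpaceType H).

Definition pair_gact (g : G * H) (p : X * Y) : X * Y :=
  (gact g.1 p.1, gact g.2 p.2).

Let pair_gact1 p : pair_gact 1 p = p.
Proof. by case: p => x y; rewrite /pair_gact /= !gact1. Qed.

Let pair_gactM g h p : pair_gact (g * h) p = pair_gact g (pair_gact h p).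
Proof. by rewrite /pair_gact /= !gactM. Qed.

Let pair_gact_continuous :
  continuous (fun p : (G * H) * (X * Y) => pair_gact p.1 p.2).
Proof.
exact: (pair_continuous
  (comp_continuous (@fst_fst_continuous G H X Y) (@gact_continuous G X))
  (comp_continuous (@snd_snd_continuous G H X Y) (@gact_continuous H Y))).
Qed.

HB.instance Definition _ := Topological_isGSpace.Build (G * H)%type (X * Y)%type
  pair_gact1 pair_gactM pair_gact_continuous.

End ProductGSpace.

Section Dynamics.
Variables (G : topologicalGroupType) (X : gSpaceType G).
Implicit Types f : X -> X.

Definition gorbit (x : X) : set X := range (fun g : G => gact g x).

Definition pseudoequivariant f :=
  continuous f /\ forall x, f @` gorbit x = gorbit (f x).

Definition G_transitive f :=
  continuous f /\
  forall U V : set X, open U -> open V -> U !=set0 -> V !=set0 ->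
    exists (g : G) (k : nat),
      (0 < k)%N /\ (gact g @` (iter k f @` U)) `&` V !=set0.

Definition totally_G_transitive f :=
  forall n : nat, (1 <= n)%N -> G_transitive (iter n f).

End Dynamics.

Definition weakly_G_mixing (G : topologicalGroupType) (X : gSpaceType G)
    (f : X -> X) :=
  continuous f /\
  @G_transitive (G * G)%type (X * X)%type (fun p => (f p.1, f p.2)).

(* Main.v *)
Require Import Defs.
From mathcomp Require Import all_boot all_classical topology.

(** Replacing open sets by their saturations under the action, one works with
    nonempty open [G]-invariant sets, which pseudoequivariance makes stable
    under preimages by [f]. On these, Furstenberg's intersection argument
    applies: the return-time sets [{k | f^k(U) meets V}] form a filter base.
    So for given [U], [V] and [n] there is [m >= 1] such that [f^m(U)] meets
    [f^-i(V)] for every [i <= n], and one of the [m + i] is a multiple of [n]. *)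

Set Implicit Arguments.
Unset Strict Implicit.
Unset Printing Implicit Defensive.

Local Open Scope classical_set_scope.

Lemma continuous_iter (T : topologicalType) (f : T -> T) n :
  continuous f -> continuous (iter n f).
Proof.
move=> fc; elim: n => [|n IHn]; first by move=> x; exact: cvg_id.
exact: (comp_continuous IHn fc).
Qed.

Section InvariantOpenSets.
Context {G : topologicalGroupType} {X : gSpaceType G}.
Implicit Types (U V : set X) (f : X -> X).

Lemma gact_continuousr (g : G) : continuous (gact g : X -> X).
Proof.
move=> x; apply: (@continuous_comp _ _ _ (fun y : X => (g, y))
  (fun p : G * X => gact p.1 p.2)); last exact: gact_continuous.
by apply: cvg_pair; [exact: cvg_cst|exact: cvg_id].
Qed.

(** This is the union of the translates of [U], written through preimages so that openness follows
    from continuity of each [gact g]. *)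
Definition saturation U : set X := [set x | exists g : G, U (gact g x)].

Definition inv_open U :=
  [/\ open U, U !=set0 & forall (g : G) x, U x -> U (gact g x)].

Lemma inv_open_saturation U : open U -> U !=set0 -> inv_open (saturation U).
Proof.
move=> oU [x Ux]; split.
- have -> : saturation U = \bigcup_(g in [set: G]) (gact g @^-1` U).
    by apply/seteqP; split=> [y [g Ugy]|y [g _ Ugy]]; exists g.
  apply: bigcup_open => g _; apply: open_comp => // y _.
  exact: gact_continuousr.
- by exists x, 1%g; rewrite gact1.
- by move=> g y [h Uhy]; exists (h * g^-1)%g; rewrite -gactM mulgVK.
Qed.

(** Each application of [f] sends an orbit into an orbit, so the group element may change at every
    step; [h] depends on [x] as well as on [g]. *)
Lemma pseudoequivariant_iter f n (g : G) x : pseudoequivariant f ->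
  exists h : G, iter n f (gact g x) = gact h (iter n f x).
Proof.
move=> [_ fG]; elim: n => [|n [h /= ->]]; first by exists g.
have : (f @` gorbit (iter n f x)) (f (gact h (iter n f x))).
  by exists (gact h (iter n f x)) => //; exists h.
by rewrite fG => -[h' _ <-]; exists h'.
Qed.

Section WeaklyMixing.
Context {f : X -> X}.
Hypotheses (f_pseudo : pseudoequivariant f) (f_mix : weakly_G_mixing f).

Lemma weakly_mixing_inv_open U1 V1 U2 V2 :
  inv_open U1 -> inv_open V1 -> inv_open U2 -> inv_open V2 ->
  exists2 k, 0 < k & (exists2 x, U1 x & V1 (iter k f x)) /\
                     (exists2 x, U2 x & V2 (iter k f x)).
Proof.
move=> [oU1 [u1 Uu1] _] [oV1 [v1 Vv1] iV1] [oU2 [u2 Uu2] _] [oV2 [v2 Vv2] iV2].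
have oM A B : open A -> open B -> open (A `*` B : set (X * X)).
  move=> oA oB; rewrite openE => -[a b] [/= Aa Bb].
  by exists (A, B) => //; split; apply: open_nbhs_nbhs.
have [_ trans] := f_mix.2.
have [||g [k [k_gt0 [_ [[_ [[x1 x2] [Ux1 Ux2] <-] <-] []]]]]] :=
  trans _ _ (oM _ _ oU1 oU2) (oM _ _ oV1 oV2).
- by exists (u1, u2).
- by exists (v1, v2).
have -> : iter k (fun p => (f p.1, f p.2)) (x1, x2) =
          (iter k f x1, iter k f x2) by elim: (k) => //= j ->.
(* Invariance of [V1] and [V2] absorbs the group elements supplied by transitivity of the product
   map. *)
move=> /= /(iV1 g.1^-1%g) + /(iV2 g.2^-1%g).
rewrite -!gactM !mulVg !gact1 => Vx1 Vx2.
by exists k => //; split; [exists x1|exists x2].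
Qed.

Lemma inv_open_preimage_iter k V : inv_open V -> inv_open (iter k f @^-1` V).
Proof.
move=> iV; have [oV _ VG] := iV; split.
- by apply: open_comp => // x _; apply: continuous_iter; exact: f_pseudo.1.
- elim: k {oV VG} V iV => [|k IHk] V iV; first by case: iV.
  have [oV _ VG] := iV.
  have iV' : inv_open (f @^-1` V).
    split; first by apply: open_comp => // x _; exact: f_pseudo.1.
      (* Nonemptiness comes from mixing, as [f] need not be surjective: [V] returns to itself at
         some positive time [j.+1], and then [iter j f x] lies in the preimage of [V]. *)
      have [[//|j] _ [[x _ Vx] _]] := weakly_mixing_inv_open iV iV iV iV.
      by exists (iter j f x).
    move=> g x Vx; have [h /= fgx] := pseudoequivariant_iter 1 g x f_pseudo.
    by rewrite /= fgx; exact: VG.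
  exact: IHk iV'.
- move=> g x Vx; have [h fgx] := pseudoequivariant_iter k g x f_pseudo.
  by rewrite /= fgx; exact: VG.
Qed.

Lemma inv_openI k U V : inv_open U -> inv_open V ->
  (exists2 x, U x & V (iter k f x)) -> inv_open (U `&` iter k f @^-1` V).
Proof.
move=> [oU _ UG] /(inv_open_preimage_iter k)[oV _ VG] [x Ux Vx]; split.
- exact: openI.
- by exists x.
- by move=> g y [Uy Vy]; split; [exact: UG|exact: VG].
Qed.

Lemma furstenberg_intersection U1 V1 U2 V2 :
  inv_open U1 -> inv_open V1 -> inv_open U2 -> inv_open V2 ->
  exists U V, [/\ inv_open U, inv_open V &
    forall k, (exists2 x, U x & V (iter k f x)) ->
      (exists2 x, U1 x & V1 (iter k f x)) /\
      (exists2 x, U2 x & V2 (iter k f x))].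
Proof.
move=> iU1 iV1 iU2 iV2.
(* Sources are paired with sources and targets with targets. If [x] goes from [U] to [V] in time
   [k], then [iter j f x] goes from [U2] to [V2] in time [k], because iterates of [f] commute. *)
have [j _ [jU jV]] := weakly_mixing_inv_open iU1 iU2 iV1 iV2.
exists (U1 `&` iter j f @^-1` U2), (V1 `&` iter j f @^-1` V2).
split; [exact: inv_openI|exact: inv_openI|].
move=> k [x [U1x U2x] [V1x V2x]]; split; first by exists x.
by exists (iter j f x) => //; rewrite -iterD addnC iterD.
Qed.

Lemma furstenberg_intersection_family U (V : nat -> set X) n :
  inv_open U -> (forall i, inv_open (V i)) ->
  exists A B, [/\ inv_open A, inv_open B &
    forall k, (exists2 x, A x & B (iter k f x)) ->
      forall i, i < n -> exists2 x, U x & V i (iter k f x)].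
Proof.
move=> iU iV; elim: n => [|n [A [B [iA iB ABP]]]]; first by exists U, U.
have [A' [B' [iA' iB' ABP']]] := furstenberg_intersection iA iB iU (iV n).
exists A', B'; split=> // k /ABP'[/ABP UVk UVn] i.
by rewrite ltnS leq_eqVlt => /predU1P[->//|/UVk].
Qed.

Lemma weakly_mixing_return_multiple n U V : 0 < n ->
  inv_open U -> inv_open V ->
  exists2 k, 0 < k & exists2 x, U x & V (iter (k * n) f x).
Proof.
move=> n_gt0 iU iV.
have [A [B [iA iB ABP]]] := furstenberg_intersection_family n.+1 iU
  (fun i => inv_open_preimage_iter i iV).
have [m m_gt0 [/ABP UVm _]] := weakly_mixing_inv_open iA iB iA iB.
(* The shift [n - m %% n] lies between 1 and [n] and takes [m] to the next multiple of [n] strictly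
   above it; the value [n] occurs when [n] divides [m], hence a family of [n.+1] sets. *)
have /UVm[x Ux Vx] : n - m %% n < n.+1 by rewrite ltnS leq_subr.
exists (m %/ n).+1 => //; exists x => //.
suff -> : (m %/ n).+1 * n = n - m %% n + m by rewrite iterD.
rewrite {3}(divn_eq m n) addnCA subnK ?mulSn 1?addnC //.
exact/ltnW/ltn_pmod.
Qed.

End WeaklyMixing.
End InvariantOpenSets.

Theorem proposition2p11 (G : topologicalGroupType) (X : gSpaceType G)
    (f : X -> X) (f_pseudo : pseudoequivariant f) (f_mix : weakly_G_mixing f) :
  totally_G_transitive f.
Proof.
move=> n n_gt0; split; first exact/continuous_iter/f_pseudo.1.
move=> U V oU oV U0 V0.
have [k k_gt0 [x [g Ugx] [h Vhx]]] :=
  weakly_mixing_return_multiple f_pseudo f_mix n_gt0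
    (inv_open_saturation oU U0) (inv_open_saturation oV V0).
(* Since [x] is the translate of [gact g x] by the inverse of [g], the orbit point reaching [V] can
   be rewritten to start from [gact g x], which is in [U]. *)
have [g' xE] :=
  pseudoequivariant_iter (k * n) g^-1%g (gact g x) f_pseudo.
move: xE Vhx; rewrite -gactM mulVg gact1 => ->; rewrite -gactM => Vx.
exists (h * g')%g, k; split=> //.
exists (gact (h * g')%g (iter (k * n) f (gact g x))); split=> //.
exists (iter (k * n) f (gact g x)) => //.
by exists (gact g x) => //; rewrite iterM.
Qed.
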